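(* For any given $k>0$, $\rho(\pi,k)=\pi+k\,d(\pi)$ is a convex function of $\pi\in[0,\Pi_0]$ with a unique minimizer $\pi^*(k)\in[0,\Pi_0]$, which is the unique solution $\pi$ of $$\sum_{j\in[J(\pi)]}\ln\frac{w_j(\pi)}{u_j(\pi)}=\frac1k .$$ The minimum value $\rho^*(k)=\min_{\pi\in[0,\Pi_0]}\rho(\pi,k)$ is $$\rho^*(k)=k\cdot\sum_{j\in[J(\pi^*(k))]}\int_{u_j(\pi^*(k))}^{w_j(\pi^*(k))}\bar P_0(x)\,\mathrm dx .$$ Additionally, $\rho^*(k)$ is a monotonically increasing function of $k$. Therefore, for a target $\tau$ in the range of $\rho^*$, the optimal value of the problem $$\inf_{k>0}k\quad\text{s.t.}\quad\tau\le\min_{\pi\in[0,\Pi_0]}\left[\pi+k\,d(\pi)\right]$$ is $k_{RS}^*:=(\rho^* )^{-1}(\tau)$.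
   Context: $P_0$ is a reference probability distribution supported on $[0,1]$ with complementary CDF $\bar P_0(x)=1-P_0(x)$; $\Pi_0:=\max_{x\in[0,1]}x\,\mathbb P_{P_0}(\tilde v\ge x)$, and $\Pi_0>0$ (the target satisfies $0<\tau\le\Pi_0$). For $\pi\in[0,\Pi_0]$, $d(\pi):=\int_0^1(\bar P_0(x)-\pi/x)^+\,\mathrm dx$, with $y^+=\max\{y,0\}$. $[N]=\{1,\dots,N\}$. Standing assumption: for every $\pi\in[0,\Pi_0]$ there are finitely many disjoint intervals on which $\bar P_0(x)$ exceeds the iso-revenue curve $\pi/x$: there exist an integer $J(\pi)\ge0$ and numbers $0\le u_1(\pi)<w_1(\pi)<u_2(\pi)<w_2(\pi)<\dots<u_{J(\pi)}(\pi)<w_{J(\pi)}(\pi)\le1$ such that $\{x\in(0,1):\bar P_0(x)>\pi/x\}$ coincides, up to finitely many points, with $\bigcup_j(u_j(\pi),w_j(\pi))$, and $\bar P_0(x)\ge\pi/x$ on $\bigcup_{j}[u_j(\pi),w_j(\pi))$. Empty sums are $0$, and $\ln(w/0)=+\infty$.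
   Formalization: Added assumption: for every π in (0,Π_0], the set of x in (0,1) with \bar P_0(x)=π/x has Lebesgue measure zero; without it the equation for π*(k) has no solution for some k>0, and the formula for ρ*(k) can fail. *)

(* Defs.v *)
From HB Require Import structures.
From mathcomp Require Import all_boot all_order all_algebra.
From mathcomp Require Import all_classical all_reals all_analysis.

Set Implicit Arguments.
Unset Strict Implicit.
Unset Printing Implicit Defensive.

Import Order.TTheory GRing.Theory Num.Theory.
Import numFieldNormedType.Exports.

Local Open Scope classical_set_scope.
Local Open Scope ring_scope.

Section RobustSatisficingPricing.
Context {R : realType} (P0 : probability (measurableTypeR R) R).

Definition Pbar (x : R) : R := 1 - fine (P0 `]-oo, x]%classic).

(* P0 `[x, +oo[ is P(v >= x), which exceeds [Pbar x] = P(v > x) by the mass of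
   an atom at x; with this left-continuous tail the supremum is a maximum. *)
Definition Pi0 : R := sup [set x * fine (P0 `[x, +oo[%classic) | x in `[0, 1]].

(* The convention p / 0 = 0 affects the integrand only at x = 0. *)
Definition dist (p : R) : R :=
  \int[lebesgue_measure]_(x in `[0, 1]) Num.max (Pbar x - p / x) 0.

Definition rho (p k : R) : R := p + k * dist p.

(* Bounded below by 0, and a minimum as soon as a minimizer exists. *)
Definition rho_star (k : R) : R := inf [set rho p k | p in `[0, Pi0]].

Definition is_minimizer (k p : R) : Prop :=
  0 <= p <= Pi0 /\ forall q : R, 0 <= q <= Pi0 -> rho p k <= rho q k.

(* The intervals are numbered from 0.  The families J, u, w are meaningful on
   [0, Pi0] only, where the strict inequalities make them unique.  An interval
   with u p j = 0 occurs only for p = 0, and the last clause then reads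
   0 <= Pbar 0 at x = 0. *)
Definition iso_revenue_intervals
    (J : R -> nat) (u w : R -> nat -> R) : Prop :=
  forall p : R, 0 <= p <= Pi0 ->
  [/\ forall j, (j < J p)%N -> [/\ 0 <= u p j, u p j < w p j & w p j <= 1],
      forall j, (j.+1 < J p)%N -> w p j < u p j.+1,
      finite_set ([set x | 0 < x < 1 /\ p / x < Pbar x] `+`
                  \bigcup_(j < J p) `]u p j, w p j[%classic) &
      forall j x, (j < J p)%N -> u p j <= x < w p j -> p / x <= Pbar x].

(* Equivalently, p |-> \int_{x Pbar x > p} dx / x is continuous on ]0, Pi0].
   Otherwise, for some k > 0, the derivative of [rho ^~ k] jumps over 0 and the
   first-order condition has no root.  Example: Pbar x = min 1 (c / x) on
   [0, 1[ with 0 < c < 1 has no interval at p = c = Pi0, and total log-length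
   ln (1 / p) > ln (1 / c) for all 0 < p < c. *)
Definition no_iso_revenue_piece : Prop :=
  forall p : R, 0 < p <= Pi0 ->
  lebesgue_measure [set x : R | 0 < x < 1 /\ Pbar x = p / x] = 0%E.

(* In \bar R the inverse of 0 is +oo, so a term with u = 0 < w is +oo. *)
Definition log_length (J : R -> nat) (u w : R -> nat -> R) (p : R) : \bar R :=
  (\sum_(j < J p) lne ((w p j)%:E / (u p j)%:E))%E.

Definition solves_foc (J : R -> nat) (u w : R -> nat -> R) (k p : R) : Prop :=
  0 <= p <= Pi0 /\ log_length J u w p = (k^-1)%:E.

Definition optimal_value (tau : R) : \bar R :=
  ereal_inf [set k%:E | k in [set k : R | 0 < k /\ tau <= rho_star k]].

End RobustSatisficingPricing.

(* Main.v *)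
Require Import Defs.
From HB Require Import structures.
From mathcomp Require Import all_boot all_order all_algebra.
From mathcomp Require Import all_classical all_reals all_analysis.
From mathcomp Require Import measurable_realfun.
From mathcomp Require Import ring lra.

Set Implicit Arguments.
Unset Strict Implicit.
Unset Printing Implicit Defensive.

Import Order.TTheory GRing.Theory Num.Theory.
Import numFieldNormedType.Exports.

Local Open Scope classical_set_scope.
Local Open Scope ring_scope.

(** Write F for the complementary CDF, A(p) for the set of x in ]0, 1[ with
    p / x < F x, and h(p) for the mass of A(p) under dx / x.  The distance
    d(p) is the integral over A(p) of F x - p / x, so formally d' = - h, and
    the stationarity condition of p + k d(p) is h(p) = 1 / k.  For p > 0 the
    set A(p) is, up to finitely many points, the union of the intervals
    ]u_j, w_j[, hence h(p) is the sum of the ln (w_j / u_j)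
    ([log_lengthE]).

    No differentiation is needed.  The positive part is convex in p, which
    integrates to the tangent inequality
      d(q) >= d(p) - (q - p) h(p)   ([excess_subgradient]),
    so a root p of h(p) = 1 / k minimizes p + k d(p).  Everything else rests
    on three properties of h on ]0, Pi0]:
    - h is strictly decreasing as long as it is positive ([log_measure_lt]):
      since F is nonincreasing, the revenue x F x cannot jump up, so just to
      the left of A(q) it takes values between p and q whenever p < q.  This
      makes the root unique and, applying the tangent inequality halfway to
      a competitor, the minimizer strict ([excess_minimizer]);
    - h is continuous ([continuous_log_measure]): the indicator of A(p) at x
      varies continuously with p except where x F x = p, a null set by
      assumption, and dominated convergence applies;
    - h exceeds any bound near 0 and vanishes at Pi0, because F stays above a
      positive constant near 0 and x F x <= Pi0.
    The intermediate value theorem yields the root ([log_measure_root]).  At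
    p = 0 some u_j is 0 and the total log-length is +oo ([log_length0]), so 0
    is not a root.

    Splitting d(p) = int_A(p) F - p h(p) at the root cancels p and leaves
    the formula for the minimum.  As k grows, the minimizer changes (1 / k
    does) and k d(p) grows for fixed p, so the minimum increases strictly;
    its inverse is then the optimal value of the constrained problem. *)

(** * Integrals over intervals *)

Section Integrals.
Context {R : realType}.
Notation mu := (@lebesgue_measure R).
Implicit Types (A B D S : set R) (f : R -> R).

Lemma measurable_fun_inv_gt0 A : measurable A -> A `<=` `]0, +oo[ ->
  measurable_fun A (fun x : R => x^-1).
Proof.
move=> mA A0; apply: (measurable_funS _ A0); first exact: measurable_itv.
apply: open_continuous_measurable_fun; first exact: interval_open.
move=> x; rewrite inE/= in_itv/= andbT => x0.
by apply: inv_continuous; rewrite gt_eqF.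
Qed.

Lemma bounded_integrable_unit A f c : measurable A -> A `<=` `[0, 1] ->
  measurable_fun A f -> (forall x, A x -> `|f x| <= c) ->
  mu.-integrable A (EFin \o f).
Proof.
move=> mA A1 mf fc; apply: measurable_bounded_integrable => //.
  apply: (@le_lt_trans _ _ (mu `[0, 1])).
    by apply: le_measure; rewrite ?inE//; exact: measurable_itv.
  by rewrite lebesgue_measure_itv/= lte_fin ltr01 oppr0 adde0 ltry.
exists c; split; first exact: num_real.
by move=> M cM x Ax; apply: (le_trans (fc _ Ax)); exact: ltW.
Qed.

Lemma subset_Rintegral A B f : measurable A -> measurable B -> A `<=` B ->
  mu.-integrable B (EFin \o f) -> (forall x, B x -> 0 <= f x) ->
  \int[mu]_(x in A) f x <= \int[mu]_(x in B) f x.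
Proof.
move=> mA mB AB intf f0; rewrite /Rintegral fine_le//.
- apply: integrable_fin_num => //; exact: integrableS intf.
- exact: integrable_fin_num.
- apply: ge0_subset_integral => //; first exact: measurable_int intf.
Qed.

Lemma integral_inv_ln (a b : R) : 0 < a -> a < b ->
  (\int[mu]_(x in `[a, b]) (x^-1)%:E = (ln b - ln a)%:E)%E.
Proof.
move=> a0 ab.
rewrite (@continuous_FTC2 _ _ (@ln R))//.
- apply: continuous_in_subspaceT => x; rewrite inE/= in_itv/= => /andP[ax _].
  by apply: inv_continuous; rewrite gt_eqF// (lt_le_trans a0).
- split.
  + move=> x; rewrite in_itv/= => /andP[ax _].
    by have := is_derive1_ln (lt_trans a0 ax) => -[].
  + exact/cvg_at_right_filter/continuous_ln.
  + exact/cvg_at_left_filter/continuous_ln/(lt_trans a0).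
- move=> x; rewrite in_itv/= => /andP[ax _].
  by rewrite derive1E; have := is_derive1_ln (lt_trans a0 ax) => -[].
Qed.

Lemma Rintegral_itvoo_inv (a b : R) : 0 < a -> a < b ->
  \int[mu]_(x in `]a, b[) x^-1 = ln b - ln a.
Proof.
move=> a0 ab; rewrite /Rintegral -(@integral_itv_bndoo _ _ _ _ true false).
  by rewrite integral_inv_ln.
apply/measurable_EFinP; apply: measurable_fun_inv_gt0 => //.
by move=> x /=; rewrite !in_itv/= andbT => /andP[ax _]; exact: lt_trans ax.
Qed.

Lemma ordered_itvs_lt (n : nat) (u w : nat -> R) :
  (forall j, (j < n)%N -> u j < w j) ->
  (forall j, (j.+1 < n)%N -> w j < u j.+1) ->
  forall i j, (i < j < n)%N -> w i < u j.
Proof.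
move=> uw wu i; elim=> [//|j IH] /andP[]; rewrite ltnS leq_eqVlt.
case/orP => [/eqP ->|ij] jn; first exact: wu.
have uj := uw _ (ltnW jn); have wj := wu _ jn.
by rewrite (lt_trans (IH _)) ?ij ?(ltnW jn) ?(lt_trans uj).
Qed.

(** Changing the domain by a finite set does not change the integral, nor does
    closing each of the disjoint intervals. *)
Lemma integral_almost_itvs S D f (n : nat) (u w : nat -> R) :
    (forall j, (j < n)%N -> u j < w j) ->
    (forall j, (j.+1 < n)%N -> w j < u j.+1) ->
    (forall j, (j < n)%N -> `]u j, w j[%classic `<=` D) ->
    finite_set (S `+` \bigcup_(j < n) `]u j, w j[%classic) ->
    measurable S -> measurable D -> S `<=` D ->
    measurable_fun D f -> (forall x, D x -> 0 <= f x) ->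
  (\int[mu]_(x in S) (f x)%:E =
   \sum_(j < n) \int[mu]_(x in `[u j, w j]) (f x)%:E)%E.
Proof.
move=> uw wu UD finN mS mD SD mf f0.
set U := \bigcup_(j < n) _ in finN *; set N := S `+` U in finN.
have mU : measurable U.
  by apply: bigcup_measurable => j _; exact: measurable_itv.
have sUD : U `<=` D by move=> x [j /= jn xj]; exact: UD xj.
have mN : measurable N.
  by apply: countable_measurable => //; exact: finite_set_countable.
have N0 : mu N = 0%E.
  by apply: countable_lebesgue_measure0; exact: finite_set_countable.
have -> : (\int[mu]_(x in S) (f x)%:E = \int[mu]_(x in U) (f x)%:E)%E.
  have mfE A : measurable A -> A `<=` D -> measurable_fun A (EFin \o f).
    by move=> mA AD; apply/measurable_EFinP; exact: measurable_funS mf.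
  rewrite (@ge0_negligible_integral _ _ _ mu S N (EFin \o f) mN mS _ _ N0)/=;
    last 2 first.
  - exact: mfE.
  - by move=> x Sx; rewrite lee_fin f0//; exact: SD.
  rewrite [RHS](@ge0_negligible_integral _ _ _ mu U N (EFin \o f) mN mU _ _
    N0)/=; last 2 first.
  - exact: mfE.
  - by move=> x Sx; rewrite lee_fin f0//; exact: sUD.
  congr (integral _ _ _); apply/seteqP; split => x [Ax nNx]; split=> //.
    by apply: contrapT => nUx; apply: nNx; left.
  by apply: contrapT => nSx; apply: nNx; right.
transitivity (\sum_(j < n) \int[mu]_(x in `]u j, w j[) (f x)%:E)%E; last first.
  apply: eq_bigr => j _.
  rewrite (@integral_itv_bndoo _ _ _ _ true false)//.
  apply/measurable_EFinP; apply: measurable_funS mf => //; exact: UD.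
have tU : trivIset [set` (index_iota 0 n)] (fun j => `]u j, w j[%classic).
  apply/trivIsetP => i j /=; rewrite !mem_index_iota/= => ni nj ij.
  have lt := ordered_itvs_lt uw wu.
  rewrite -subset0 => x /= []; rewrite !in_itv/=.
  move=> /andP[uix xwi] /andP[ujx xwj].
  case: ltngtP ij => // ij _.
  - have := lt _ _ (introT andP (conj ij nj)) => h.
    by have := lt_trans (lt_trans xwi h) ujx; rewrite ltxx.
  - have := lt _ _ (introT andP (conj ij ni)) => h.
    by have := lt_trans (lt_trans xwj h) uix; rewrite ltxx.
have UE : U = \big[setU/set0]_(j <- index_iota 0 n) `]u j, w j[%classic.
  by rewrite /U bigcup_mkord big_mkord.
rewrite UE ge0_integral_bigsetU//.
- by rewrite big_mkord.
- exact: iota_uniq.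
- by rewrite -UE; apply/measurable_EFinP; apply: measurable_funS mf.
- by rewrite -UE => x Ux; rewrite lee_fin f0//; exact: sUD.
Qed.

End Integrals.

(** * The demand excess over an iso-revenue curve *)

Section Demand.
Context {R : realType} (F : R -> R).
Hypothesis F_noninc : nonincreasing_fun F.
Hypothesis F_ge0 : forall x, 0 <= F x.
Hypothesis F_le1 : forall x, F x <= 1.
Notation mu := (@lebesgue_measure R).
Implicit Types p q x : R.

Definition above p : set R := [set x | 0 < x < 1 /\ p / x < F x].
(** [dist P0] is convertible to [excess (Pbar P0)]. *)
Definition excess p : R := \int[mu]_(x in `[0, 1]) Num.max (F x - p / x) 0.
(** The mass of [above p] for dx / x, which is minus the slope of [excess]. *)
Definition log_measure p : R := \int[mu]_(x in above p) x^-1.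

Let measurable_F (D : set R) : measurable D -> measurable_fun D F.
Proof. by move=> mD; exact: nonincreasing_measurable. Qed.

Let measurable_inv (D : set R) : measurable D -> D `<=` `]0, 1[%classic ->
  measurable_fun D (fun x : R => x^-1).
Proof.
move=> mD D01; apply: measurable_fun_inv_gt0 => // x /D01.
by rewrite /= !in_itv/= andbT => /andP[].
Qed.

Let measurable_margin p (D : set R) : measurable D -> D `<=` `]0, 1[%classic ->
  measurable_fun D (fun x => F x - p / x).
Proof.
move=> mD D01; apply: measurable_funB; first exact: measurable_F.
by apply: measurable_funM => //; exact: measurable_inv.
Qed.

Lemma aboveP p x : above p x <-> 0 < x < 1 /\ p < x * F x.
Proof.
split=> -[x01]; have x0 : 0 < x by case/andP: x01.
  by rewrite ltr_pdivrMr// mulrC.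
by move=> pxF; split=> //; rewrite ltr_pdivrMr// mulrC.
Qed.

Lemma above_sub p : above p `<=` `]0, 1[%classic.
Proof. by move=> x [x01 _]; rewrite /= in_itv. Qed.

Lemma above_sub01 p : above p `<=` `[0, 1]%classic.
Proof. by move=> x /above_sub; exact: subset_itv_oo_cc. Qed.

Lemma subset_above p q : p <= q -> above q `<=` above p.
Proof.
by move=> pq x /aboveP[x01 qx]; apply/aboveP; split=> //; exact: le_lt_trans qx.
Qed.

(** As [F] is at most 1, [above p] stays away from 0 when [p] is positive, so
    that dx / x is finite on it. *)
Lemma gt_above p x : above p x -> p < x.
Proof.
move=> /aboveP[/andP[x0 x1] px]; apply: (lt_le_trans px).
by rewrite ler_piMr// ltW.
Qed.

Lemma measurable_above p : measurable (above p).
Proof.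
have -> : above p = `]0, 1[%classic `&` (fun x => p / x < F x) @^-1` [set true].
  by apply/seteqP; split=> x; rewrite /above/= in_itv/= => -[].
apply: measurable_fun_ltr => //; last exact: measurable_F.
by apply: measurable_funM => //; exact: measurable_inv.
Qed.
Hint Resolve measurable_above : core.

Lemma integrable_inv_above p : 0 < p ->
  mu.-integrable (above p) (EFin \o (fun x : R => x^-1)).
Proof.
move=> p0; apply: (@bounded_integrable_unit _ _ _ p^-1) => //.
- exact: above_sub01.
- by apply: measurable_inv => //; exact: above_sub.
move=> x /gt_above px; have x0 := lt_trans p0 px.
by rewrite gtr0_norm ?invr_gt0// lef_pV2// ltW.
Qed.

Lemma integrable_iso_above p q : 0 < p ->
  mu.-integrable (above p) (EFin \o (fun x : R => q / x)).
Proof.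
move=> p0.
have := @integrableZl _ _ _ mu _ (measurable_above p) q _
  (integrable_inv_above p0).
apply: eq_integrable; first exact: measurable_above.
by move=> x _; rewrite /= EFinM.
Qed.

Lemma integrable_F_above p : mu.-integrable (above p) (EFin \o F).
Proof.
apply: (@bounded_integrable_unit _ _ _ 1) => //.
- exact: above_sub01.
- exact: measurable_F.
by move=> x _; rewrite ger0_norm.
Qed.

Lemma integrable_excess p : 0 <= p ->
  mu.-integrable `]0, 1[ (EFin \o (fun x => Num.max (F x - p / x) 0)).
Proof.
move=> p0; apply: (@bounded_integrable_unit _ _ _ 1) => //.
- exact: subset_itv_oo_cc.
- by apply: measurable_maxr => //; exact: measurable_margin.
move=> x /=; rewrite in_itv/= => /andP[x0 _].
rewrite ger0_norm ?le_max ?lexx ?orbT// ge_max ler01 andbT.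
by rewrite (le_trans _ (F_le1 x))// lerBlDr lerDl divr_ge0// ltW.
Qed.

Lemma excess_oo p : excess p = \int[mu]_(x in `]0, 1[) Num.max (F x - p / x) 0.
Proof.
rewrite /excess /Rintegral (@integral_itv_bndoo _ _ _ _ true false)//.
apply/measurable_EFinP.
by apply: measurable_maxr => //; exact: measurable_margin.
Qed.

Lemma excess_above p : excess p = \int[mu]_(x in above p) (F x - p / x).
Proof.
have -> : above p = `]0, 1[%classic `&` above p.
  by rewrite setIidr//; exact: above_sub.
rewrite excess_oo Rintegral_mkcondr; apply: eq_Rintegral => x.
rewrite inE/= in_itv/= patchE => x01; case: ifPn => [|/negP].
  by rewrite inE => -[_ pF]; rewrite max_l// subr_ge0 ltW.
rewrite inE => nA; rewrite max_r// subr_le0 leNgt; apply/negP => pF.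
by apply: nA; split.
Qed.

Lemma Rintegral_margin p q : 0 < p ->
  \int[mu]_(x in above p) (F x - q / x) =
  \int[mu]_(x in above p) F x - q * log_measure p.
Proof.
move=> p0; rewrite RintegralB//; last 3 first.
- exact: measurable_above.
- exact: integrable_F_above.
- exact: integrable_iso_above.
by rewrite RintegralZl//; [exact: measurable_above|exact: integrable_inv_above].
Qed.

Lemma excess_revenue p : 0 < p ->
  excess p = \int[mu]_(x in above p) F x - p * log_measure p.
Proof. by move=> p0; rewrite excess_above Rintegral_margin. Qed.

(** For each x, p |-> max (F x - p / x) 0 is convex with slope - 1 / x on
    [above p]: restricting the integral for [q] to [above p] and dropping the
    maximum there only decreases it. *)
Lemma excess_subgradient p q : 0 < p -> 0 <= q ->
  excess p - (q - p) * log_measure p <= excess q.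
Proof.
move=> p0 q0; rewrite (excess_oo q).
have iI := integrable_inv_above p0; have iF := integrable_F_above p.
have iqI := integrable_iso_above q p0.
apply: (@le_trans _ _ (\int[mu]_(x in above p) Num.max (F x - q / x) 0));
  last first.
  apply: subset_Rintegral => //; first exact: above_sub.
    exact: integrable_excess.
  by move=> x _; rewrite le_max lexx orbT.
apply: (@le_trans _ _ (\int[mu]_(x in above p) (F x - q / x))).
  by rewrite excess_revenue// Rintegral_margin//; lra.
apply: le_Rintegral => //; first exact: measurable_above.
- have := @integrableB _ _ _ mu _ (measurable_above p) _ _ iF iqI.
  by apply: eq_integrable => //; exact: measurable_above.
- apply: integrableS (integrable_excess q0) => //.
    exact: measurable_above.
  exact: above_sub.
- by move=> x _; rewrite le_max lexx.
Qed.

(** If z is in [above q] and x < z, then x F x >= x F z > x q / z, which is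
    at least p as soon as x >= z p / q.  Letting z tend to the infimum x0 of
    [above q] shows that [above p] contains the interval ]x0 p / q, x0[ in
    addition to [above q]. *)
Lemma log_measure_lt p q : 0 < p -> p < q -> above q !=set0 ->
  log_measure q < log_measure p.
Proof.
move=> p0 pq q_ne; have q0 := lt_trans p0 pq.
pose x0 := inf (above q).
have lbq : lbound (above q) q by move=> x /gt_above /ltW.
have hiq : has_inf (above q) by split=> //; exists q.
have qx0 : q <= x0 by apply: lb_le_inf.
have x00 : 0 < x0 by exact: lt_le_trans qx0.
have lbx0 x : above q x -> x0 <= x by move=> qx; apply: ge_inf => //; case: hiq.
pose y0 := x0 * p / q.
have y00 : 0 < y0 by rewrite divr_gt0// mulr_gt0.
have y0x0 : y0 < x0 by rewrite /y0 -mulrA gtr_pMr// ltr_pdivrMr// mul1r.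
have sub : above q `|` `]y0, x0[ `<=` above p.
  move=> x [|/=]; first exact/subset_above/ltW.
  rewrite in_itv/= => /andP[y0x xx0]; have x_gt0 := lt_trans y00 y0x.
  have [z qz zx] : exists2 z, above q z & z < x * q / p.
    apply: inf_lt => //; move: y0x; rewrite /y0 -/x0.
    by rewrite ltr_pdivrMr// ltr_pdivlMr.
  have xz : x < z by rewrite (lt_le_trans xx0)// lbx0.
  case/aboveP: qz => /andP[z0 z1] qz; apply/aboveP; split.
    by rewrite x_gt0 (lt_trans xz).
  have /(ler_wpM2l (ltW x_gt0)) : F z <= F x by apply: F_noninc; exact: ltW.
  apply: lt_le_trans; move: zx; rewrite ltr_pdivlMr// => zx.
  rewrite -(ltr_pM2l z0) (lt_trans zx)// [ltRHS]mulrCA ltr_pM2l//.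
have mU : measurable (above q `|` `]y0, x0[) by apply: measurableU.
have iU : mu.-integrable (above q `|` `]y0, x0[) (EFin \o (fun x : R => x^-1)).
  apply: integrableS (integrable_inv_above p0) => //.
  exact: measurable_above.
have : \int[mu]_(x in above q `|` `]y0, x0[) x^-1 <= log_measure p.
  apply: subset_Rintegral => //.
  - exact: integrable_inv_above.
  - by move=> x /gt_above px; rewrite invr_ge0 ltW// (lt_trans p0).
apply: lt_le_trans; rewrite Rintegral_setU//; last 2 first.
  exact: measurable_above.
  rewrite disj_set2E; apply/eqP; rewrite -subset0 => x [/lbx0 x0x /=].
  by rewrite in_itv/= => /andP[_ /(le_lt_trans x0x)]; rewrite ltxx.
rewrite ltrDl Rintegral_itvoo_inv// subr_gt0 ltr_ln//.
Qed.

(** Off the null set where F x = p / x, membership of x in [above q] does not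
    depend on q in a neighbourhood of p; dominated convergence applies with
    the bound 2 / p, since [above q] lies to the right of p / 2 for q near
    p. *)
Lemma continuous_log_measure p : 0 < p ->
  mu [set x | 0 < x < 1 /\ F x = p / x] = 0%E ->
  {for p, continuous log_measure}.
Proof.
move=> p0 flat0; apply/(@cvg_nbhsP _ R^o) => y yp.
pose g x : R := (p / 2)^-1.
have p20 : 0 < p / 2 by rewrite divr_gt0.
have [N _ yN] : \forall n \near \oo, p / 2 < y n.
  by apply: (cvgr_gt p yp); rewrite ltr_pdivrMr// ltr_pMr// ltr1n.
(* From rank N on, y n > p / 2, so the domination holds at every rank. *)
rewrite -(cvg_shiftn N).
pose f (n : nat) x := ((fun x => x^-1) \_ (above (y (n + N)%N))) x.
pose f0 x := ((fun x => x^-1) \_ (above p)) x.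
have lE q : log_measure q =
    \int[mu]_(x in `]0, 1[) ((fun x => x^-1) \_ (above q)) x.
  by rewrite -Rintegral_mkcondr setIidr//; exact: above_sub.
have mf q : measurable_fun (`]0, 1[%classic : set R)
    ((fun x : R => x^-1) \_ (above q)).
  have mA : measurable (above q) by exact: measurable_above.
  apply/measurable_restrict => //.
  by apply: measurable_inv; [exact: measurableI|exact: subIsetl].
have yn n : p / 2 < y (n + N)%N by apply: yN; rewrite /= leq_addl.
have ub n x : `|f n x| <= g x.
  rewrite /f /g patchE; case: ifPn => [|_]; last by rewrite normr0 invr_ge0 ltW.
  rewrite inE => /gt_above yx; have px := lt_trans (yn n) yx.
  have x0 := lt_trans p20 px.
  by rewrite gtr0_norm ?invr_gt0// lef_pV2// ltW.
have [] := @dominated_convergence _ _ _ mu `]0, 1[ _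
  (fun n => EFin \o f n) (EFin \o f0) (EFin \o g).
- by [].
- by move=> n; apply/measurable_EFinP; exact: mf.
- by apply/measurable_EFinP; exact: mf.
- exists [set x | 0 < x < 1 /\ F x = p / x]; split=> //.
    have -> : [set x | 0 < x < 1 /\ F x = p / x] =
        `]0, 1[%classic `&` (fun x => F x == p / x) @^-1` [set true].
      apply/seteqP; split=> x /=; rewrite in_itv/= => -[x01].
        by move=> ->; rewrite eqxx.
      by move/eqP.
    apply: measurable_fun_eqr => //; first exact: measurable_F.
    by apply: measurable_funM => //; exact: measurable_inv.
  move=> x /= /not_implyP[]; rewrite in_itv/= => x01 nlim; split=> //.
  apply: contrapT => Fpx; apply: nlim; apply/cvg_EFin; first exact: nearW.
  have x0 : 0 < x by case/andP: x01.
  apply: cvg_near_cst; rewrite /f /f0.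
  have yNp : (fun n => y (n + N)%N) @ \oo --> p by rewrite (cvg_shiftn N).
  have [pF|Fp|/esym//] := ltgtP (p / x) (F x).
    have : p < x * F x by rewrite mulrC -ltr_pdivrMr.
    move=> /(cvgr_lt p yNp); apply: filterS => n ynF.
    rewrite /= !patchE !mem_set//.
    by apply/aboveP; split.
  have : x * F x < p by rewrite mulrC -ltr_pdivlMr.
  move=> /(cvgr_gt p yNp); apply: filterS => n ynF.
  rewrite /= !patchE !memNset// => -[_]; first by rewrite ltNge (ltW Fp).
  by rewrite ltr_pdivrMr// mulrC ltNge (ltW ynF).
- apply: (@bounded_integrable_unit _ _ _ (p / 2)^-1) => //.
  - exact: subset_itv_oo_cc.
  - exact: measurable_cst.
  - by move=> x _; rewrite ger0_norm// invr_ge0 ltW.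
- by apply: aeW => x n _; rewrite lee_fin ub.
move=> if0 _ lim.
have lfin : (\int[mu]_(x in `]0%R, 1%R[) (EFin \o f0) x = (log_measure p)%:E)%E.
  by rewrite lE /Rintegral fineK//; exact: integrable_fin_num.
rewrite lfin in lim.
rewrite (_ : [sequence log_measure (y (n + N)%N)]_n =
  fine \o (fun n => (\int[mu]_(x in `]0%R, 1%R[) (EFin \o f n) x)%E)).
  exact: fine_cvg lim.
by apply/funext => n; rewrite /= lE.
Qed.

(** Where F >= c, the revenue x F x exceeds p as soon as x > p / c; the bound
    tends to infinity as p tends to 0. *)
Lemma log_measure_ge p c x0 : 0 < p -> 0 < c -> x0 <= 1 -> p < c * x0 ->
    (forall x, x < x0 -> c <= F x) ->
  ln x0 - ln (p / c) <= log_measure p.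
Proof.
move=> p0 c0 x01 px0 cF; have pc0 : 0 < p / c by rewrite divr_gt0.
have pcx0 : p / c < x0 by rewrite ltr_pdivrMr// mulrC.
rewrite -Rintegral_itvoo_inv//.
apply: subset_Rintegral => //.
- move=> x /=; rewrite in_itv/= => /andP[px xx0]; have x_gt0 := lt_trans pc0 px.
  apply/aboveP; split; first by rewrite x_gt0 (lt_le_trans xx0).
  move: px; rewrite ltr_pdivrMr// => /lt_le_trans; apply.
  by rewrite ler_wpM2l ?cF// ltW.
- exact: integrable_inv_above.
- by move=> x /gt_above px; rewrite invr_ge0 ltW// (lt_trans p0).
Qed.

Lemma excess_convex p q (t s : R) : 0 <= p -> 0 <= q -> 0 <= t -> 0 <= s ->
  t + s = 1 -> excess (t * p + s * q) <= t * excess p + s * excess q.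
Proof.
move=> p0 q0 t0 s0 ts.
have m01 : measurable (`]0, 1[%classic : set R) by [].
have mul_int r : 0 <= r -> forall a, mu.-integrable `]0, 1[
    (EFin \o (fun x => a * Num.max (F x - r / x) 0)).
  move=> r0 a.
  have := @integrableZl _ _ _ mu _ m01 a _ (integrable_excess r0).
  by apply: eq_integrable.
rewrite !excess_oo -!RintegralZl//; [|exact: integrable_excess..].
rewrite -RintegralD//; [|exact: mul_int..].
apply: le_Rintegral => //.
- by apply: integrable_excess; rewrite addr_ge0// mulr_ge0.
- have := @integrableD _ _ _ mu _ m01 _ _ (mul_int _ p0 t) (mul_int _ q0 s).
  by apply: eq_integrable.
move=> x _; rewrite ge_max; apply/andP; split; last first.
  by rewrite addr_ge0// mulr_ge0// le_max lexx orbT.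
have -> : F x - (t * p + s * q) / x = t * (F x - p / x) + s * (F x - q / x).
  by rewrite -{1}[F x]mul1r -ts; ring.
by rewrite lerD// ler_wpM2l// le_max lexx.
Qed.

Lemma above_neq0 p : 0 < log_measure p -> above p !=set0.
Proof.
move=> h0; apply/set0P/eqP => A0; move: h0.
by rewrite /log_measure A0 Rintegral_set0 ltxx.
Qed.

Lemma log_measure_ge0 p : 0 <= log_measure p.
Proof.
apply: Rintegral_ge0 => x /above_sub/=.
by rewrite in_itv/= invr_ge0 => /andP[/ltW].
Qed.

Lemma log_measure_lt_gt0 p q : 0 < p -> p < q -> 0 < log_measure p ->
  log_measure q < log_measure p.
Proof.
move=> p0 pq hp; have := log_measure_ge0 q; rewrite le_eqVlt.
by case/predU1P => [<-//|/above_neq0]; exact: log_measure_lt.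
Qed.

(** The tangent at the root [p] shows that [p] is a minimizer.  For strictness
    the tangent is taken at the midpoint m of p and q: by strict monotonicity
    of [log_measure], 1 - k h(m) has the sign of q - m. *)
Lemma excess_minimizer k p q : 0 < k -> 0 < p -> log_measure p = k^-1 ->
  0 <= q -> q != p -> p + k * excess p < q + k * excess q.
Proof.
move=> k0 p0 hp q0 qp; have hp0 : 0 < log_measure p by rewrite hp invr_gt0.
have tangent m r : 0 < m -> 0 <= r ->
    m + k * excess m + (r - m) * (1 - k * log_measure m) <= r + k * excess r.
  move=> m0 r0; have /(ler_wpM2l (ltW k0)) := excess_subgradient m0 r0.
  by lra.
have pm m : 0 < m -> p + k * excess p <= m + k * excess m.
  move=> m0; have := tangent p m p0 (ltW m0).
  by rewrite hp mulfV ?gt_eqF// subrr mulr0 addr0.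
pose m := (p + q) / 2.
have m0 : 0 < m by rewrite /m; lra.
apply: (le_lt_trans (pm m m0)); apply: lt_le_trans (tangent m q m0 q0).
rewrite ltrDl.
have [qp'|pq|/eqP] := ltgtP q p; last by rewrite (negbTE qp).
- rewrite nmulr_rgt0; last by rewrite /m; lra.
  rewrite subr_lt0 -ltr_pdivrMl// mulr1 -hp.
  by apply: log_measure_lt (above_neq0 hp0) => //; rewrite /m; lra.
- rewrite pmulr_rgt0; last by rewrite /m; lra.
  rewrite subr_gt0 -ltr_pdivlMl// mulr1 -hp.
  by apply: log_measure_lt_gt0 => //; rewrite /m; lra.
Qed.

Lemma log_measure_root M c x0 l : 0 < l -> 0 < c -> 0 < x0 -> x0 <= 1 ->
    c * x0 <= M -> (forall x, x < x0 -> c <= F x) ->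
    (forall x, 0 < x < 1 -> x * F x <= M) ->
    (forall p, 0 < p <= M -> mu [set x | 0 < x < 1 /\ F x = p / x] = 0%E) ->
  exists2 p, 0 < p <= M & log_measure p = l.
Proof.
move=> l0 c0 x00 x01 cM cF FM flat0.
have cx0 : 0 < c * x0 by rewrite mulr_gt0.
(* The lower bound of log_measure_ge at p0 is ln x0 - ln (p0 / c) = l. *)
pose p0 := c * x0 * expR (- l).
have p00 : 0 < p0 by rewrite mulr_gt0// expR_gt0.
have p0c : p0 < c * x0.
  by rewrite gtr_pMr// expR_lt1 oppr_lt0.
have p0M : p0 <= M by rewrite (le_trans (ltW p0c)).
have hp0 : l <= log_measure p0.
  apply: le_trans (log_measure_ge p00 c0 x01 p0c cF).
  have -> : p0 / c = x0 * expR (- l) by rewrite /p0; field; rewrite gt_eqF.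
  by rewrite lnM ?posrE ?expR_gt0// expRK; lra.
have hM : log_measure M = 0.
  rewrite /log_measure (_ : above M = set0) ?Rintegral_set0//.
  by rewrite -subset0 => x /aboveP[/FM + +]; rewrite leNgt => /negP.
have [||p] := @IVT R log_measure p0 M l p0M.
- apply: continuous_in_subspaceT => p; rewrite inE/= in_itv/= => /andP[p0p pM].
  have pgt0 := lt_le_trans p00 p0p.
  by apply: continuous_log_measure => //; rewrite flat0// pgt0.
- by rewrite hM ge_min le_max (ltW l0) hp0 orbT.
rewrite in_itv/= => /andP[p0p pM] hp; exists p => //.
by rewrite pM (lt_le_trans p00).
Qed.

End Demand.

(** * The tail of a probability distribution *)

Section Tail.
Context {R : realType} (P0 : probability (measurableTypeR R) R).
Implicit Types x y : R.

Let fin (A : set R) : measurable A -> P0 A \is a fin_num.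
Proof. by move=> mA; exact: fin_num_measure. Qed.

Let fine_mono (A B : set R) : measurable A -> measurable B -> A `<=` B ->
  fine (P0 A) <= fine (P0 B).
Proof. by move=> mA mB AB; rewrite fine_le ?fin// le_measure ?inE. Qed.

Let fine_prob (A : set R) : measurable A -> 0 <= fine (P0 A) <= 1.
Proof.
move=> mA; rewrite fine_ge0//=.
by rewrite -lee_fin fineK ?fin// probability_le1.
Qed.

Lemma PbarE x : Pbar P0 x = fine (P0 `]x, +oo[%classic).
Proof.
have -> : `]x, +oo[%classic = ~` `]-oo, x]%classic by rewrite setCitvl.
by rewrite probability_setC// fineB ?fin.
Qed.

Lemma Pbar_nonincreasing : nonincreasing_fun (Pbar P0).
Proof.
by move=> x y xy; rewrite /Pbar lerB// fine_mono//; exact: subset_itvl.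
Qed.

Lemma Pbar_ge0 x : 0 <= Pbar P0 x.
Proof. by rewrite PbarE fine_ge0. Qed.

Lemma Pbar_le1 x : Pbar P0 x <= 1.
Proof.
by rewrite PbarE; case/andP: (@fine_prob `]x, +oo[%classic (measurable_itv _)).
Qed.

Lemma revenue_has_sup :
  has_sup [set x * fine (P0 `[x, +oo[%classic) | x in `[0, 1]].
Proof.
split; first by exists (0 * fine (P0 `[0, +oo[%classic)); exists 0;
  rewrite //= bound_itvE.
exists 1 => _ [x /= + <-]; rewrite in_itv/= => /andP[x0 x1].
have /andP[f0 f1] : 0 <= fine (P0 `[x, +oo[%classic) <= 1 by exact: fine_prob.
by rewrite -[1]mulr1 ler_pM.
Qed.

Lemma revenue_le_Pi0 x :
  0 <= x <= 1 -> x * fine (P0 `[x, +oo[%classic) <= Pi0 P0.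
Proof.
move=> x01; apply: sup_upper_bound; first exact: revenue_has_sup.
by exists x => //=; rewrite in_itv.
Qed.

Lemma revenue_Pbar_le_Pi0 x : 0 < x < 1 -> x * Pbar P0 x <= Pi0 P0.
Proof.
move=> /andP[x0 x1]; have x01 : 0 <= x <= 1 by rewrite !ltW.
apply: le_trans (revenue_le_Pi0 x01).
rewrite PbarE; apply: ler_wpM2l; first exact: ltW.
by apply: fine_mono => // y /=; rewrite !in_itv/= !andbT; exact: ltW.
Qed.

(** A price x0 of positive revenue has c = P(v >= x0) > 0, and the tail is at
    least c to the left of x0. *)
Lemma revenue_witness : 0 < Pi0 P0 -> exists c x0 : R,
  [/\ 0 < c, 0 < x0 <= 1, c * x0 <= Pi0 P0 &
      forall x, x < x0 -> c <= Pbar P0 x].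
Proof.
move=> Pi0_gt0.
have [_ [x /= x01 <-] xP] := sup_adherent Pi0_gt0 revenue_has_sup.
rewrite in_itv/= in x01; rewrite -/(Pi0 P0) subrr in xP.
have /andP[x0 x1] := x01.
have xgt0 : 0 < x.
  by rewrite lt_def x0 andbT; apply: contraTneq xP => ->; rewrite mul0r ltxx.
exists (fine (P0 `[x, +oo[%classic)), x; split.
- by rewrite pmulr_rgt0 in xP.
- by rewrite xgt0.
- by rewrite mulrC revenue_le_Pi0.
- move=> y yx; rewrite PbarE fine_mono// => z /=; rewrite !in_itv/= !andbT.
  exact: lt_le_trans.
Qed.

End Tail.

(** * The intervals of excess demand *)

Section Intervals.
Context {R : realType} (P0 : probability (measurableTypeR R) R).
Context (J : R -> nat) (u w : R -> nat -> R).
Hypothesis HJuw : iso_revenue_intervals P0 J u w.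
Notation F := (Pbar P0).
Notation mu := (@lebesgue_measure R).
Implicit Types p : R.

Let le_Pi0 p : 0 < p <= Pi0 P0 -> 0 <= p <= Pi0 P0.
Proof. by move=> /andP[/ltW ->]. Qed.

(* If u p j were 0, then p / x <= F x <= 1 for arbitrarily small x > 0. *)
Let gt0_u p j : 0 < p <= Pi0 P0 -> (j < J p)%N -> 0 < u p j.
Proof.
move=> pPi jJ; have /andP[p0 _] := pPi.
have [uw _ _ above_iso] := HJuw (le_Pi0 pPi).
have [u0 uwj w1] := uw _ jJ.
rewrite lt_def u0 andbT; apply/eqP => uE; move: uwj; rewrite uE => w0.
have [x [x0 xw xp]] : exists x, [/\ 0 < x, x < w p j & x < p].
  exists (Num.min (w p j) p / 2).
  have [m0 mw mp] : [/\ 0 < Num.min (w p j) p, Num.min (w p j) p <= w p j &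
      Num.min (w p j) p <= p] by rewrite lt_min w0 p0 !ge_min !lexx orbT.
  by move: (Num.min _ _) m0 mw mp => m m0 mw mp; split; lra.
have := above_iso j x jJ; rewrite uE (ltW x0) xw => /(_ isT).
move=> /le_trans/(_ (Pbar_le1 _ _)).
by rewrite ler_pdivrMr// mul1r leNgt xp.
Qed.

Let itvs_oo01 p j : 0 < p <= Pi0 P0 -> (j < J p)%N ->
  `]u p j, w p j[%classic `<=` `]0, 1[%classic.
Proof.
move=> pPi jJ; have u0 := gt0_u pPi jJ.
have [uw _ _ _] := HJuw (le_Pi0 pPi).
have [_ _ w1] := uw _ jJ.
by apply: subset_itv; rewrite bnd_simp// ltW.
Qed.

Let integral_above p (f : R -> R) : 0 < p <= Pi0 P0 ->
    measurable_fun (`]0, 1[%classic : set R) f ->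
    (forall x, 0 < x < 1 -> 0 <= f x) ->
  (\int[mu]_(x in above F p) (f x)%:E =
   \sum_(j < J p) \int[mu]_(x in `[u p j, w p j]) (f x)%:E)%E.
Proof.
move=> pPi mf f0.
have [uw wu finN _] := HJuw (le_Pi0 pPi).
apply: (@integral_almost_itvs _ _ `]0, 1[%classic) => //.
- by move=> j /uw[].
- by move=> j; exact: itvs_oo01.
- by apply: measurable_above; exact: Pbar_nonincreasing.
- exact: above_sub.
Qed.

Lemma log_lengthE p : 0 < p <= Pi0 P0 ->
  log_length J u w p = (log_measure F p)%:E.
Proof.
move=> pPi.
have [uw _ _ _] := HJuw (le_Pi0 pPi).
rewrite /log_measure /Rintegral fineK; last first.
  apply: integrable_fin_num => //.
    by apply: measurable_above; exact: Pbar_nonincreasing.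
  apply: integrable_inv_above; first exact: Pbar_nonincreasing.
  - exact: Pbar_le1.
  - by case/andP: pPi.
rewrite integral_above//; last 2 first.
- apply: measurable_fun_inv_gt0 => // x /=; rewrite !in_itv/= andbT.
  by case/andP.
- by move=> x /andP[x0 _]; rewrite invr_ge0 ltW.
apply: eq_bigr => j _; have u0 := gt0_u pPi (ltn_ord j).
have [_ uwj _] := uw _ (ltn_ord j).
have w0 := lt_trans u0 uwj.
rewrite integral_inv_ln// inver gt_eqF// -EFinM /lne leNgt divr_gt0//=.
by rewrite ln_div ?posrE.
Qed.

Lemma Rintegral_Pbar_above p : 0 < p <= Pi0 P0 ->
  \int[mu]_(x in above F p) F x =
  \sum_(j < J p) \int[mu]_(x in `[u p j, w p j]) F x.
Proof.
move=> pPi.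
have [uw _ _ _] := HJuw (le_Pi0 pPi).
rewrite [LHS]/Rintegral integral_above//; last 2 first.
- by apply: nonincreasing_measurable => //; exact: Pbar_nonincreasing.
- by move=> x _; exact: Pbar_ge0.
rewrite -sum_fine// => j _.
apply: integrable_fin_num => //.
have [u0 _ w1] := uw _ (ltn_ord j).
apply: (@bounded_integrable_unit _ _ _ 1) => //.
- by apply: subset_itv; rewrite bnd_simp.
- by apply: nonincreasing_measurable => //; exact: Pbar_nonincreasing.
- by move=> x _; rewrite ger0_norm ?Pbar_ge0 ?Pbar_le1.
Qed.

(** Near 0 the tail is positive, so infinitely many points of [above 0] lie to
    the left of any positive number: some interval must start at 0, and its
    log-length is infinite. *)
Lemma log_length0 : 0 < Pi0 P0 -> log_length J u w 0 = +oo%E.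
Proof.
move=> Pi0_gt0.
have [c [x0 [c0 /andP[x00 x01] _ cF]]] := revenue_witness Pi0_gt0.
have Pi0_itv0 : (0 : R) <= 0 <= Pi0 P0 by apply/andP; split=> //; exact: ltW.
have [uw _ finN _] := HJuw Pi0_itv0.
have [j0 uj0] : exists j : 'I_(J 0), u 0 j = 0.
  apply: contrapT => /forallNP u_neq0.
  have u_gt0 (j : 'I_(J 0)) : 0 < u 0 j.
    by have [u0 _ _] := uw _ (ltn_ord j); rewrite lt_def u0 andbT; apply/eqP.
  pose m := \big[Num.min/x0]_(j < J 0) u 0 j.
  have m0 : 0 < m.
    by rewrite /m; elim/big_ind: _ => // a b a0 b0; rewrite lt_min a0.
  have mx0 : m <= x0 by exact: bigmin_le_id.
  have sub : `]0, m[%classic `<=`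
      [set x | 0 < x < 1 /\ 0 / x < F x] `+`
      \bigcup_(j < J 0) `]u 0 j, w 0 j[%classic.
    move=> x /=; rewrite in_itv/= => /andP[xgt0 xm]; left; split.
      split; first by rewrite xgt0 (lt_le_trans xm)// (le_trans mx0).
      by rewrite mul0r (lt_le_trans c0)// cF// (lt_le_trans xm).
    move=> [j /= jJ]; rewrite in_itv/= => /andP[ujx _].
    have : m <= u 0 (Ordinal jJ) by exact: bigmin_le_cond.
    by rewrite leNgt (lt_trans ujx).
  have := countable_lebesgue_measure0
    (finite_set_countable (sub_finite_set sub finN)).
  rewrite lebesgue_measure_itv/= lte_fin m0 oppr0 adde0 => -[mE].
  by rewrite mE ltxx in m0.
apply/esum_eqyP => [j _|].
  have [u0 uwj _] := uw _ (ltn_ord j); have w0 := le_lt_trans u0 uwj.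
  have [->|uj] := eqVneq (u 0 j) 0.
    by rewrite inver eqxx gt0_muley ?lte_fin.
  by rewrite inver (negbTE uj) -EFinM /lne leNgt divr_gt0// lt_def u0 uj.
exists j0; split => //.
have [u0 uwj _] := uw _ (ltn_ord j0); have w0 := le_lt_trans u0 uwj.
by rewrite inver uj0 eqxx gt0_muley ?lte_fin.
Qed.

End Intervals.

(** * Minimization of the robust revenue *)

Section Pricing.
Context {R : realType} (P0 : probability (measurableTypeR R) R).
Hypotheses (Pi0_gt0 : 0 < Pi0 P0) (Hpiece : no_iso_revenue_piece P0).
Notation F := (Pbar P0).
Implicit Types p q k : R.

Lemma rho_starE k p : is_minimizer P0 k p -> rho_star P0 k = rho P0 p k.
Proof.
move=> [p01 pmin].
have lb : lbound [set rho P0 q k | q in `[0, Pi0 P0]] (rho P0 p k).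
  by move=> _ [q /= + <-]; rewrite in_itv/=; exact: pmin.
have img : [set rho P0 q k | q in `[0, Pi0 P0]] (rho P0 p k).
  by exists p; rewrite //= in_itv.
apply/eqP; rewrite eq_le; apply/andP; split.
  by apply: ge_inf => //; exists (rho P0 p k).
by apply: lb_le_inf => //; exists (rho P0 p k).
Qed.

Lemma convex_rho k : 0 < k ->
  convex_function `[0, Pi0 P0] (fun p : R => rho P0 p k).
Proof.
move=> k0 t p q; rewrite !inE/= !in_itv/= => /andP[p0 _] /andP[q0 _].
have t0 : 0 <= t%:num by [].
have s0 : 0 <= 1 - t%:num by rewrite subr_ge0.
have ts : t%:num + (1 - t%:num) = 1 :> R by rewrite addrC subrK.
have conv_dist : dist P0 (t%:num * p + (1 - t%:num) * q) <=
    t%:num * dist P0 p + (1 - t%:num) * dist P0 q.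
  by apply: (excess_convex (@Pbar_nonincreasing _ P0) (Pbar_le1 P0)).
move/(ler_wpM2l (ltW k0)) in conv_dist.
change (rho P0 (t%:num * p + (1 - t%:num) * q) k <=
  t%:num * rho P0 p k + (1 - t%:num) * rho P0 q k).
by rewrite /rho; lra.
Qed.

Lemma foc_root k : 0 < k -> exists p, [/\ 0 < p <= Pi0 P0,
  log_measure F p = k^-1 &
  forall q, 0 <= q -> q != p -> rho P0 p k < rho P0 q k].
Proof.
move=> k0; have [c [x0 [c0 /andP[x00 x01] cM cF]]] := revenue_witness Pi0_gt0.
have ik0 : 0 < k^-1 by rewrite invr_gt0.
have Fni := @Pbar_nonincreasing _ P0; have F0 := Pbar_ge0 P0.
have F1 := Pbar_le1 P0.
have [p pPi hp] := log_measure_root Fni F1 ik0 c0 x00 x01 cM cF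
  (@revenue_Pbar_le_Pi0 _ P0) Hpiece.
exists p; split=> // q q0 qp.
by apply: excess_minimizer => //; case/andP: pPi.
Qed.

(** With p1, p2 the minimizers for k1 < k2, they differ as 1 / k1 <> 1 / k2,
    so rho p1 k1 < rho p2 k1 <= rho p2 k2. *)
Lemma rho_star_increasing k1 k2 : 0 < k1 -> k1 < k2 ->
  rho_star P0 k1 < rho_star P0 k2.
Proof.
move=> k1_gt0 k12; have k2_gt0 := lt_trans k1_gt0 k12.
have minE k p : 0 < p <= Pi0 P0 ->
    (forall q, 0 <= q -> q != p -> rho P0 p k < rho P0 q k) ->
    rho_star P0 k = rho P0 p k.
  move=> /andP[p0 pPi] pmin; apply: rho_starE; split; first by rewrite ltW.
  move=> q /andP[q0 _]; have [->//|qp] := eqVneq q p.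
  exact/ltW/pmin.
have [p1 [p1Pi h1 min1]] := foc_root k1_gt0.
have [p2 [p2Pi h2 min2]] := foc_root k2_gt0.
rewrite (minE _ _ p1Pi min1) (minE _ _ p2Pi min2).
have /andP[p2_gt0 _] := p2Pi.
have p21 : p2 != p1.
  apply: contra_eq_neq h2 => ->; rewrite h1 (inj_eq invr_inj).
  by rewrite lt_eqF.
apply: (lt_le_trans (min1 _ (ltW p2_gt0) p21)).
rewrite /rho lerD2l; apply: ler_wpM2r; last exact: ltW.
by apply: Rintegral_ge0 => x _; rewrite le_max lexx orbT.
Qed.

(** By strict monotonicity the feasible set is the half-line from [k]. *)
Lemma optimal_valueE k tau : 0 < k -> rho_star P0 k = tau ->
  optimal_value P0 tau = k%:E.
Proof.
move=> k0 ktau; apply/eqP; rewrite eq_le; apply/andP; split.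
  by apply: ereal_inf_lbound; exists k => //=; rewrite ktau.
apply: le_ereal_inf_tmp => _ [l /= [l0 taul] <-]; rewrite lee_fin leNgt.
apply/negP => lk; have := rho_star_increasing l0 lk.
by rewrite ktau ltNge taul.
Qed.

End Pricing.

Theorem theorem1 (R : realType) (P0 : probability (measurableTypeR R) R)
    (P0_supp : P0 `[0, 1]%classic = 1%E) (Pi0_gt0 : 0 < Pi0 P0)
    (J : R -> nat) (u w : R -> nat -> R)
    (HJuw : iso_revenue_intervals P0 J u w)
    (Hpiece : no_iso_revenue_piece P0) :
  [/\ (forall k : R, 0 < k ->
        convex_function `[0, Pi0 P0] (fun p : R => rho P0 p k) /\
        exists p : R,
          [/\ unique (is_minimizer P0 k) p,
              unique (solves_foc P0 J u w k) p &
              rho_star P0 k =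
                k * \sum_(j < J p)
                      \int[lebesgue_measure]_(x in `[u p j, w p j]) Pbar P0 x]),
      (forall k1 k2 : R, 0 < k1 -> k1 < k2 ->
        rho_star P0 k1 < rho_star P0 k2) &
      (forall tau : R, 0 < tau -> tau <= Pi0 P0 ->
        (exists k : R, 0 < k /\ rho_star P0 k = tau) ->
        exists kRS : R,
          unique (fun k => 0 < k /\ rho_star P0 k = tau) kRS /\
          optimal_value P0 tau = kRS%:E)].
Proof.
split; last 2 first.
- exact: rho_star_increasing.
- move=> tau _ _ [k [k0 ktau]]; exists k; split; last exact: optimal_valueE.
  split=> // l [l0 ltau].
  have [kl|lk|//] := ltgtP k l.
  + by have := rho_star_increasing Pi0_gt0 Hpiece k0 kl; rewrite ktau ltau ltxx.
  + by have := rho_star_increasing Pi0_gt0 Hpiece l0 lk; rewrite ktau ltau ltxx.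
move=> k k0; split; first exact: convex_rho.
have [p [pPi hp pmin]] := foc_root Pi0_gt0 Hpiece k0.
have /andP[p0 pPi'] := pPi.
have p01 : 0 <= p <= Pi0 P0 by rewrite ltW.
have pminimizer : is_minimizer P0 k p.
  split=> // q /andP[q0 _]; have [->//|qp] := eqVneq q p.
  exact/ltW/pmin.
exists p; split.
- split=> // q [/andP[q0 qPi] qmin].
  apply/eqP; rewrite eq_sym; apply: contraT => /(pmin _ q0).
  by rewrite ltNge qmin.
- split; first by split=> //; rewrite (log_lengthE HJuw pPi) hp.
  move=> q [/andP[q0 qPi]]; move: q0; rewrite le_eqVlt => /predU1P[<-|q0].
    by rewrite (log_length0 HJuw Pi0_gt0).
  have qPi' : 0 < q <= Pi0 P0 by rewrite q0.
  rewrite (log_lengthE HJuw qPi') => -[hq].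
  have h0 (r : R) : log_measure (Pbar P0) r = k^-1 ->
      0 < log_measure (Pbar P0) r.
    by move=> ->; rewrite invr_gt0.
  have lt := @log_measure_lt_gt0 _ _ (@Pbar_nonincreasing _ P0)
    (@Pbar_le1 _ P0).
  have [pq|qp|//] := ltgtP p q.
  + by have := lt _ _ p0 pq (h0 _ hp); rewrite hp hq ltxx.
  + by have := lt _ _ q0 qp (h0 _ hq); rewrite hp hq ltxx.
- rewrite (rho_starE pminimizer) /rho.
  rewrite (_ : dist P0 p = excess (Pbar P0) p)// excess_revenue//; last 3 first.
  + exact: Pbar_nonincreasing.
  + exact: Pbar_ge0.
  + exact: Pbar_le1.
  rewrite hp (Rintegral_Pbar_above HJuw pPi); field.
  by rewrite gt_eqF.
Qed.
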